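(* Suppose that the tensor linear system $\mathcal{A} * \mathcal{X} = \mathcal{B}$ is consistent, let $\mathcal{X}^0\in\mathbb{R}^{\ell\times p\times n}$, and let $\mathcal{X}_*^0 = \mathcal{A}^\dagger * \mathcal{B} + (\mathcal{I} - \mathcal{A}^\dagger * \mathcal{A}) * \mathcal{X}^0$. Let $P_m$ be the set of all permutations of $[m]$ and $\rho := \max_{\pi\in P_m}\rho_\pi$. Then $\rho<1$, and the sequence $\{\mathcal{X}^k\}_{k\ge0}$ generated by the TKGK algorithm satisfies $$\|\mathcal{X}^k-\mathcal{X}_*^0\|_F^2\le\rho^k\,\|\mathcal{X}^0-\mathcal{X}_*^0\|_F^2 .$$ Furthermore, if $\mathcal{X}^0\in\operatorname{range}_K(\mathcal{A}^\top)$, then $\mathcal{X}_*^0=\mathcal{A}^\dagger*\mathcal{B}$, and hence $\{\mathcal{X}^k\}_{k\ge0}$ converges to the unique least-norm solution $\mathcal{A}^\dagger*\mathcal{B}$.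
   Context: Tensor notation. For $\mathcal{A}\in\mathbb{R}^{m\times \ell\times n}$ let $A_1,\dots,A_n$ be its frontal slices. $\operatorname{bcirc}(\mathcal{A})\in\mathbb{R}^{mn\times \ell n}$ is the block circulant matrix whose first block column is $A_1,\dots,A_n$ (top to bottom) and whose $(i,j)$ block is $A_{((i-j) \bmod n)+1}$. $\operatorname{unfold}(\mathcal{A})\in\mathbb{R}^{mn\times \ell}$ stacks $A_1,\dots,A_n$ vertically, and $\operatorname{fold}$ is its inverse. The $t$-product is $\mathcal{A} * \mathcal{Y} = \operatorname{fold}(\operatorname{bcirc}(\mathcal{A})\operatorname{unfold}(\mathcal{Y}))$. $\mathcal{A}^\dagger$ is the tensor with $\operatorname{bcirc}(\mathcal{A}^\dagger)=\operatorname{bcirc}(\mathcal{A})^\dagger$ (Moore-Penrose), $\mathcal{A}^\top$ the tensor with $\operatorname{bcirc}(\mathcal{A}^\top)=\operatorname{bcirc}(\mathcal{A})^\top$. $\mathcal{I}$ is the identity tensor (first frontal slice the identity matrix, others zero). $\|\cdot\|_F$ is the norm of the entrywise inner product, $\|\cdot\|_2$ the spectral norm. $\operatorname{vec}(\mathcal{A})$ stacks the column-wise vectorizations of $A_1,\dots,A_n$. $\mathcal{A}_{i::}\in\mathbb{R}^{1\times \ell\times n}$ is the $i$th horizontal slice. $\operatorname{range}_K(\mathcal{A}^\top)=\{\mathcal{A}^\top*\mathcal{Y}\mid\mathcal{Y}\in\mathbb{R}^{m\times p\times n}\}$. The least-norm solution is the solution of $\mathcal{A}*\mathcal{X}=\mathcal{B}$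 of smallest $\|\cdot\|_F$. Problem: $\mathcal{A}\in\mathbb{R}^{m\times\ell\times n}$, $\mathcal{B}\in\mathbb{R}^{m\times p\times n}$, unknown $\mathcal{X}\in\mathbb{R}^{\ell\times p\times n}$. Projections. $\mathcal{P}_i(\mathcal{X}) = \mathcal{X} - \mathcal{A}_{i::}^\dagger * (\mathcal{A}_{i::}*\mathcal{X} - \mathcal{B}_{i::})$. For a permutation $\pi=(\pi_1,\dots,\pi_m)$ of $[m]=\{1,\dots,m\}$, $\mathcal{P}_{\pi} = \mathcal{P}_{\pi_m}\circ\cdots\circ\mathcal{P}_{\pi_1}$, and $r_{\pi}(\mathcal{X})\in\mathbb{R}^{mn\ell\times p}$ is the vertical stacking over $i=1,\dots,m$ of the blocks $$\operatorname{unfold}\big(\mathcal{A}_{\pi_i::}^\dagger * (\mathcal{A}_{\pi_i::} * (\mathcal{P}_{\pi_{i-1}}\circ\cdots\circ\mathcal{P}_{\pi_1})(\mathcal{X}) - \mathcal{B}_{\pi_i::})\big)$$ (for $i=1$ the composition is the identity). Further, $$\mathcal{T}_{\pi} = (\mathcal{I} - \mathcal{A}_{\pi_m::}^\dagger * \mathcal{A}_{\pi_m::}) * \cdots * (\mathcal{I} - \mathcal{A}_{\pi_1::}^\dagger * \mathcal{A}_{\pi_1::}),\qquad \rho_{\pi} = \|\operatorname{bcirc}(\mathcal{T}_{\pi} * \mathcal{A}^\dagger * \mathcal{A})\|_2^2 .$$ Permutation strategies: incremental (IS): $\pi_k=(1,\dots,m)$ for all $k$; shuffle-once (SO): one random permutation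 $\pi_0$ drawn at the start and $\pi_k=\pi_0$ for all $k$; random reshuffling (RR): a fresh random permutation $\pi_k$ of $[m]$ at each $k$. TKGK algorithm. Input $\mathcal{A},\mathcal{B}$, integer $\tau\ge1$, $\mathcal{X}^0$, and a strategy in $\{\mathrm{IS},\mathrm{SO},\mathrm{RR}\}$. For $k=0,1,\dots$: generate $\pi_k$; set $\delta_k=\|\mathcal{P}_{\pi_k}(\mathcal{X}^k)-\mathcal{X}^k\|_F^2$ and stop if $\delta_k=0$; set $\gamma_k=\tfrac12(\|r_{\pi_k}(\mathcal{X}^k)\|_F^2+\delta_k)$ and $j_{k,\tau}=\max\{k-\tau+1,0\}$; with $\vec{x}^i=\operatorname{vec}(\mathcal{X}^i)$, $\vec{d}^k=\operatorname{vec}(\mathcal{P}_{\pi_k}(\mathcal{X}^k)-\mathcal{X}^k)$ and $$M_k=[\vec{x}^{j_{k,\tau}}-\vec{x}^k,\dots,\vec{x}^{k-1}-\vec{x}^k,\vec{d}^k]\in\mathbb{R}^{\ell pn\times(k-j_{k,\tau}+1)},$$ let $s^k$ solve $M_k^\top M_k s^k=\gamma_k e$, where $e$ is the last standard basis vector of $\mathbb{R}^{k-j_{k,\tau}+1}$; set $$\mathcal{X}^{k+1}=\mathcal{X}^k+\sum_{i=1}^{k-j_{k,\tau}}s_i^k(\mathcal{X}^{j_{k,\tau}+i-1}-\mathcal{X}^k)+s^k_{k-j_{k,\tau}+1}(\mathcal{P}_{\pi_k}(\mathcal{X}^k)-\mathcal{X}^k).$$ If the algorithm stops at index $k$, the sequence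 is understood to be constant, equal to $\mathcal{X}^k$, from then on. *)

(* Defs.v *)
From mathcomp Require Import all_boot all_order all_algebra perm.
From mathcomp Require Import all_classical all_reals all_analysis.

Set Implicit Arguments.
Unset Strict Implicit.
Unset Printing Implicit Defensive.

Import Order.TTheory GRing.Theory Num.Theory.
Import numFieldNormedType.Exports.

Local Open Scope classical_set_scope.
Local Open Scope ring_scope.

Section Matrices.
Variable R : realType.

Definition mxdot m n (M N : 'M[R]_(m, n)) : R := \sum_i \sum_j M i j * N i j.

Definition mxnormF m n (M : 'M[R]_(m, n)) : R := Num.sqrt (mxdot M M).

(* The operator norm induced by the Euclidean norms; taking the closed unit
   ball rather than the sphere keeps the set nonempty when n = 0. *)
Definition spectral_norm m n (M : 'M[R]_(m, n)) : R :=
  sup [set mxnormF (M *m x) | x in [set x : 'cV[R]_n | mxnormF x <= 1]].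

(* The four Penrose equations: N is the Moore-Penrose inverse of M. *)
Definition is_pinv m n (M : 'M[R]_(m, n)) (N : 'M[R]_(n, m)) : Prop :=
  [/\ M *m N *m M = M, N *m M *m N = N,
      (M *m N)^T = M *m N & (N *m M)^T = N *m M].

(* The default value 0 is never used: see pinvP. *)
Definition pinv m n (M : 'M[R]_(m, n)) : 'M[R]_(n, m) :=
  xget 0 [set N | is_pinv M N].

Lemma mxdot_tr m n (M : 'M[R]_(m, n)) : mxdot M M = \tr (M^T *m M).
Proof.
rewrite /mxdot /mxtrace exchange_big; apply: eq_bigr => j _.
by rewrite mxE; apply: eq_bigr => i _; rewrite mxE.
Qed.

Lemma mxdot_eq0 m n (M : 'M[R]_(m, n)) : mxdot M M = 0 -> M = 0.
Proof.
move=> M0; apply/matrixP => i j; rewrite mxE; apply/eqP; rewrite -sqrf_eq0.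
have sq_ge0 k h : 0 <= M k h * M k h by rewrite -expr2 sqr_ge0.
have /psumr_eq0P/(_ M0 i isT) Mi0 : forall k, true -> 0 <= \sum_h M k h * M k h.
  by move=> k _; apply: sumr_ge0 => h _.
have /psumr_eq0P/(_ Mi0 j isT) : forall h, true -> 0 <= M i h * M i h by [].
by rewrite expr2 => ->.
Qed.

Lemma mulmx_tr_unit r n (C : 'M[R]_(r, n)) : row_free C -> C *m C^T \in unitmx.
Proof.
move=> Cfree; rewrite -row_free_unit -kermx_eq0; apply/eqP.
set K := kermx _; have K0 : K *m (C *m C^T) = 0 by exact: mulmx_ker.
suff KC0 : K *m C = 0 by apply: (row_free_inj Cfree); rewrite /= KC0 mul0mx.
apply: trmx_inj; rewrite trmx0; apply: mxdot_eq0.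
by rewrite mxdot_tr trmxK trmx_mul mulmxA -(mulmxA K) K0 mul0mx mxtrace0.
Qed.

Lemma is_pinv_mul m r n (C : 'M[R]_(m, r)) (W : 'M[R]_(r, n)) :
  row_free C^T -> row_free W ->
  is_pinv (C *m W) (W^T *m invmx (W *m W^T) *m (invmx (C^T *m C) *m C^T)).
Proof.
move=> /mulmx_tr_unit; rewrite trmxK => uC /mulmx_tr_unit uW.
set W' := W^T *m _; set C' := _ *m C^T.
have WW' : W *m W' = 1%:M by rewrite mulmxA mulmxV.
have C'C : C' *m C = 1%:M by rewrite -mulmxA mulVmx.
have MN : C *m W *m (W' *m C') = C *m C' by rewrite -mulmxA (mulmxA W) WW' mul1mx.
have NM : W' *m C' *m (C *m W) = W' *m W by rewrite -mulmxA (mulmxA C') C'C mul1mx.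
split; rewrite ?MN ?NM.
- by rewrite -mulmxA (mulmxA C') C'C mul1mx.
- by rewrite -mulmxA (mulmxA W) WW' mul1mx.
- by rewrite /C' !trmx_mul trmxK trmx_inv trmx_mul trmxK mulmxA.
- by rewrite /W' !trmx_mul trmxK trmx_inv trmx_mul trmxK mulmxA.
Qed.

Lemma pinv_exists m n (M : 'M[R]_(m, n)) : exists N, is_pinv M N.
Proof.
rewrite -[M]mulmx_base; eexists; apply: is_pinv_mul; last exact: row_base_free.
by rewrite /row_free mxrank_tr; exact: col_base_full.
Qed.

Lemma is_pinv_uniq m n (M : 'M[R]_(m, n)) N N' :
  is_pinv M N -> is_pinv M N' -> N = N'.
Proof.
move=> [a1 a2 a3 a4] [b1 b2 b3 b4].
have MN : M *m N = M *m N'.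
  rewrite -a3 -{1}b1 -(mulmxA _ M N) trmx_mul a3 b3 mulmxA.
  by rewrite a1.
have NM : N *m M = N' *m M.
  rewrite -a4 -{1}b1 -(mulmxA M) mulmxA trmx_mul b4 a4.
  by rewrite -mulmxA (mulmxA M) a1.
by rewrite -a2 NM -mulmxA MN mulmxA b2.
Qed.

Lemma pinvP m n (M : 'M[R]_(m, n)) : is_pinv M (pinv M).
Proof.
rewrite /pinv; case: xgetP => [N _ //|noN].
by have [N /noN] := pinv_exists M.
Qed.

End Matrices.

(* A tensor in R^(m x l x n) is the family of its frontal slices; slice k here
   is the slice of index k + 1 in the usual one-based numbering. *)
Definition tensor (R : realType) (m l n : nat) : Type :=
  {ffun 'I_n -> 'M[R]_(m, l)}.

Section Tensors.
Variables (R : realType) (n : nat).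
Notation T m l := (tensor R m l n.+1).
Notation bdim m := (\sum_(k < n.+1) m)%N.

(* The subtraction on 'I_n.+1 is that of the integers modulo n + 1. *)
Definition bcirc m l (A : T m l) : 'M[R]_(bdim m, bdim l) :=
  \mxblock_(i < n.+1, j < n.+1) A (i - j).

Definition unfold m l (A : T m l) : 'M[R]_(bdim m, l) := \mxcol_(k < n.+1) A k.

Definition fold m l (M : 'M[R]_(bdim m, l)) : T m l :=
  [ffun k => submxcol M k].

Definition tprod m l p (A : T m l) (Y : T l p) : T m p :=
  fold (bcirc A *m unfold Y).

(* Reads off the first block column: the inverse of bcirc on block circulant
   matrices, see bcircK. *)
Definition unbcirc m l (M : 'M[R]_(bdim m, bdim l)) : T m l :=
  [ffun k => submxblock M k 0].

Definition tpinv m l (A : T m l) : T l m := unbcirc (pinv (bcirc A)).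

Definition ttr m l (A : T m l) : T l m := unbcirc (bcirc A)^T.

Definition tid m : T m m := [ffun k => if k == 0 then 1%:M else 0].

Definition tdot m l (A B : T m l) : R := \sum_k mxdot (A k) (B k).

Definition tnorm m l (A : T m l) : R := Num.sqrt (tdot A A).

(* mxvec lists entries row by row, so the transpose gives the column-wise
   vectorization. *)
Definition vec m l (A : T m l) : 'cV[R]_(\sum_(k < n.+1) (l * m)) :=
  \mxcol_(k < n.+1) (mxvec (A k)^T)^T.

Definition hslice m l (A : T m l) (i : 'I_m) : T 1 l := [ffun k => row i (A k)].

Definition rangeK m l p (A : T m l) : set (T m p) :=
  [set tprod A Y | Y in [set: T l p]].

Lemma bcircK m l : cancel (@bcirc m l) (@unbcirc m l).
Proof. by move=> A; apply/ffunP => k; rewrite ffunE mxblockK subr0. Qed.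

Lemma foldK m l : cancel (@unfold m l) (@fold m l).
Proof. by move=> A; apply/ffunP => k; rewrite ffunE mxcolK. Qed.

Lemma unfoldK m l : cancel (@fold m l) (@unfold m l).
Proof.
move=> M; rewrite -[RHS]submxcolK; apply: eq_mxcol => k.
by rewrite ffunE.
Qed.

Lemma ttrE m l (A : T m l) : bcirc (ttr A) = (bcirc A)^T.
Proof.
rewrite /ttr /bcirc tr_mxblock; apply: eq_mxblock => i j.
by rewrite ffunE mxblockK sub0r opprB.
Qed.

Let shift m l c (M : 'M[R]_(bdim m, bdim l)) : 'M[R]_(bdim m, bdim l) :=
  \mxblock_(i < n.+1, j < n.+1) submxblock M (i + c) (j + c).

Let shiftM m l q c (M : 'M[R]_(bdim m, bdim l)) (N : 'M[R]_(bdim l, bdim q)) :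
  shift c (M *m N) = shift c M *m shift c N.
Proof.
rewrite /shift mul_mxblock; apply: eq_mxblock => i j.
rewrite -{1}(submxblockK M) -{1}(submxblockK N) mul_mxblock mxblockK.
by rewrite (reindex_inj (addIr c)).
Qed.

Let shift_tr m l c (M : 'M[R]_(bdim m, bdim l)) : shift c M^T = (shift c M)^T.
Proof.
by rewrite /shift tr_mxblock; apply: eq_mxblock => i j; apply/matrixP=> a b; rewrite !mxE.
Qed.

Let shift_bcirc m l c (A : T m l) : shift c (bcirc A) = bcirc A.
Proof.
by apply: eq_mxblock => i j; rewrite mxblockK opprD addrACA subrr addr0.
Qed.

Lemma tpinvE m l (A : T m l) : bcirc (tpinv A) = pinv (bcirc A).
Proof.
have shiftN c : shift c (pinv (bcirc A)) = pinv (bcirc A).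
  have [a1 a2 a3 a4] := pinvP (bcirc A).
  apply: (@is_pinv_uniq _ _ _ (bcirc A)) => //.
  rewrite -{1}(shift_bcirc c A); split.
  - by rewrite -!shiftM a1.
  - by rewrite -!shiftM a2.
  - by rewrite -shiftM -shift_tr a3.
  - by rewrite -shiftM -shift_tr a4.
rewrite -[RHS]submxblockK; apply: eq_mxblock => i j.
by rewrite ffunE -[in RHS](shiftN (- j)) mxblockK subrr.
Qed.

End Tensors.

Notation "A *t B" := (tprod A B) (at level 40, left associativity) : ring_scope.

Section LinearSystem.
Variables (R : realType) (m l p n : nat).
Variables (A : tensor R m l n.+1) (B : tensor R m p n.+1).

Definition solution (X : tensor R l p n.+1) : Prop := A *t X = B.

Definition least_norm_solution (X : tensor R l p n.+1) : Prop :=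
  solution X /\ forall Y, solution Y -> tnorm X <= tnorm Y.

Definition Xstar (X0 : tensor R l p n.+1) : tensor R l p n.+1 :=
  tpinv A *t B + (tid R n l - tpinv A *t A) *t X0.

Definition residual (i : 'I_m) (X : tensor R l p n.+1) : tensor R l p n.+1 :=
  tpinv (hslice A i) *t (hslice A i *t X - hslice B i).

Definition proj (i : 'I_m) (X : tensor R l p n.+1) : tensor R l p n.+1 :=
  X - residual i X.

(* The first projection to be applied is the one of index pi 0. *)
Definition proj_prefix (pi : 'S_m) (i : nat) (X : tensor R l p n.+1) :=
  foldl (fun Y j => proj j Y) X [seq pi j | j <- take i (enum 'I_m)].

Definition proj_perm (pi : 'S_m) (X : tensor R l p n.+1) := proj_prefix pi m X.

Definition residual_perm (pi : 'S_m) (X : tensor R l p n.+1) :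
    'M[R]_(\sum_(i < m) \sum_(k < n.+1) l, p) :=
  \mxcol_(i < m) unfold (residual (pi i) (proj_prefix pi i X)).

Definition T_perm (pi : 'S_m) : tensor R l l n.+1 :=
  foldl (fun T j => (tid R n l - tpinv (hslice A j) *t hslice A j) *t T)
    (tid R n l) [seq pi j | j <- enum 'I_m].

Definition rho_perm (pi : 'S_m) : R :=
  spectral_norm (bcirc (T_perm pi *t tpinv A *t A)) ^+ 2.

(* rho_perm is nonnegative and 'S_m is nonempty, so that starting the iterated
   maximum from 0 does not change its value. *)
Definition rho_max : R := \big[Num.max/0]_(pi : 'S_m) rho_perm pi.

End LinearSystem.

Inductive strategy := IS | SO | RR.

(* The sequences of permutations that can be drawn by a strategy. *)
Definition drawn_by (m : nat) (st : strategy) (pi : nat -> 'S_m) : Prop :=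
  match st with
  | IS => forall k, pi k = 1%g
  | SO => exists pi0, forall k, pi k = pi0
  | RR => True
  end.

Section TKGK.
Variables (R : realType) (m l p n : nat).
Variables (A : tensor R m l n.+1) (B : tensor R m p n.+1).
Variables (tau : nat) (pi : nat -> 'S_m) (X : nat -> tensor R l p n.+1).

Definition tkgk_dir (k : nat) : tensor R l p n.+1 :=
  proj_perm A B (pi k) (X k) - X k.

Definition tkgk_delta (k : nat) : R := tnorm (tkgk_dir k) ^+ 2.

Definition tkgk_gamma (k : nat) : R :=
  2^-1 * (mxnormF (residual_perm A B (pi k) (X k)) ^+ 2 + tkgk_delta k).

(* Truncated subtraction: this is max(k - tau + 1, 0). *)
Definition tkgk_j (k : nat) : nat := (k.+1 - tau)%N.

Definition tkgk_M (k : nat) :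
    'M[R]_(\sum_(i < n.+1) (p * l), (k - tkgk_j k) + 1) :=
  row_mx (\matrix_(a < _, i < k - tkgk_j k) (vec (X (tkgk_j k + i)) - vec (X k)) a 0)
         (vec (tkgk_dir k)).

Definition tkgk_update (k : nat) (s : 'cV[R]_((k - tkgk_j k) + 1)) :
    tensor R l p n.+1 :=
  X k + \sum_(i < k - tkgk_j k) s (lshift 1 i) 0 *: (X (tkgk_j k + i) - X k)
      + s (rshift (k - tkgk_j k) 0) 0 *: tkgk_dir k.

(* The algorithm has stopped at some index at most k. *)
Definition tkgk_stopped (k : nat) : Prop :=
  exists2 i, (i <= k)%N & tkgk_delta i = 0.

Definition tkgk_step (k : nat) : Prop :=
  (tkgk_stopped k -> X k.+1 = X k) /\
  (~ tkgk_stopped k -> exists2 s,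
     (tkgk_M k)^T *m tkgk_M k *m s
       = tkgk_gamma k *: delta_mx (rshift (k - tkgk_j k) 0) 0
     & X k.+1 = tkgk_update s).

Definition tkgk (X0 : tensor R l p n.+1) : Prop :=
  X 0%N = X0 /\ forall k, tkgk_step k.

End TKGK.

(* Main.v *)
Require Import Defs.
From mathcomp Require Import all_boot all_order all_algebra perm.
From mathcomp Require Import all_classical all_reals all_analysis.
From mathcomp Require Import ring lra.

Set Implicit Arguments.
Unset Strict Implicit.
Unset Printing Implicit Defensive.

Import Order.TTheory GRing.Theory Num.Theory.
Import numFieldNormedType.Exports.

Local Open Scope classical_set_scope.
Local Open Scope ring_scope.

(** Fix a solution Y. Relative to Y, each row projection is the orthogonal
    projection along the range of A_i^+, so the Pythagorean identities of one
    sweep telescope; this shows that gamma_k = <d^k, Y - X^k>, whichever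
    solution Y is taken. By induction Y - X^k is orthogonal to the stored
    differences X^i - X^k, so the linear system of step k is the system of
    normal equations for projecting Y onto X^k + range M_k. Hence it is
    solvable, and X^(k+1) is at least as close to Y as X^k + d^k = P_pi(X^k).
    For Y = X_*^0 the error stays in the range of A^+ A, where a sweep contracts
    the squared norm by rho_pi. Finally rho_pi < 1: in the homogeneous
    case a sweep that preserves the norm of E has zero residuals, so A * E = 0,
    which forces E = 0 on the range of A^+ A. *)

(** * Frobenius inner product and spectral norm *)

Section Matrices.
Variable R : realType.

Lemma mxdot_trM m n (M N : 'M[R]_(m, n)) : mxdot M N = \tr (M^T *m N).
Proof.
rewrite /mxdot /mxtrace exchange_big; apply: eq_bigr => j _.
by rewrite mxE; apply: eq_bigr => i _; rewrite mxE.
Qed.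

Lemma mxdotC m n (M N : 'M[R]_(m, n)) : mxdot M N = mxdot N M.
Proof. by rewrite !mxdot_trM -mxtrace_tr trmx_mul trmxK. Qed.

Lemma mxdotDr m n (M N P : 'M[R]_(m, n)) :
  mxdot M (N + P) = mxdot M N + mxdot M P.
Proof. by rewrite !mxdot_trM mulmxDr raddfD. Qed.

Lemma mxdotZr m n a (M N : 'M[R]_(m, n)) : mxdot M (a *: N) = a * mxdot M N.
Proof. by rewrite !mxdot_trM -scalemxAr mxtraceZ. Qed.

Lemma mxdot0r m n (M : 'M[R]_(m, n)) : mxdot M 0 = 0.
Proof. by rewrite mxdot_trM mulmx0 mxtrace0. Qed.

Lemma mxdotNr m n (M N : 'M[R]_(m, n)) : mxdot M (- N) = - mxdot M N.
Proof. by rewrite -scaleN1r mxdotZr mulN1r. Qed.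

Lemma mxdot_ge0 m n (M : 'M[R]_(m, n)) : 0 <= mxdot M M.
Proof.
by apply: sumr_ge0 => i _; apply: sumr_ge0 => j _; rewrite -expr2 sqr_ge0.
Qed.

Lemma mxdot_mulmxl m n q (M : 'M[R]_(m, n)) (X : 'M[R]_(n, q))
    (Y : 'M[R]_(m, q)) :
  mxdot (M *m X) Y = mxdot X (M^T *m Y).
Proof. by rewrite !mxdot_trM trmx_mul mulmxA. Qed.

Lemma mxnormF_sqr m n (M : 'M[R]_(m, n)) : mxnormF M ^+ 2 = mxdot M M.
Proof. by rewrite sqr_sqrtr ?mxdot_ge0. Qed.

Lemma mxnormF0 m n : mxnormF (0 : 'M[R]_(m, n)) = 0.
Proof. by rewrite /mxnormF mxdot0r sqrtr0. Qed.

Lemma mxdot_sqrB m n a (X Y : 'M[R]_(m, n)) :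
  mxdot (X - a *: Y) (X - a *: Y)
  = mxdot X X - 2 * a * mxdot X Y + a ^+ 2 * mxdot Y Y.
Proof.
rewrite !(mxdotDr, mxdotNr, mxdotZr) (mxdotC _ X) (mxdotC _ Y).
rewrite !(mxdotDr, mxdotNr, mxdotZr) (mxdotC Y X); ring.
Qed.

Lemma mxdot_CauchySchwarz m n (X Y : 'M[R]_(m, n)) :
  mxdot X Y ^+ 2 <= mxdot X X * mxdot Y Y.
Proof.
have := mxdot_ge0 Y; rewrite le_eqVlt => /orP[/eqP/esym/mxdot_eq0 ->|Y_gt0].
  by rewrite !mxdot0r mulr0 expr0n.
(* This coefficient makes the remainder orthogonal to [Y]; its squared norm, multiplied by that of
   [Y], is the gap in the inequality. *)
have := mxdot_ge0 (X - (mxdot X Y / mxdot Y Y) *: Y).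
rewrite mxdot_sqrB -(ler_pM2r Y_gt0) mul0r => le0.
rewrite -subr_ge0; apply: le_trans le0 _; rewrite le_eqVlt; apply/orP; left.
by apply/eqP; field; rewrite gt_eqF.
Qed.

(** Cauchy-Schwarz applied to each row of [M]: the Frobenius norm dominates the operator norm. *)
Lemma mxdot_mulmx_le m n (M : 'M[R]_(m, n)) (x : 'cV[R]_n) :
  mxdot (M *m x) (M *m x) <= mxdot M M * mxdot x x.
Proof.
rewrite {1 2}/mxdot mulr_suml; apply: ler_sum => i _; rewrite big_ord1 -expr2.
have -> : (M *m x) i 0 = mxdot (row i M)^T x.
  by rewrite mxE; apply: eq_bigr => j _; rewrite big_ord1 !mxE.
apply: le_trans (mxdot_CauchySchwarz _ _) _.
rewrite le_eqVlt; apply/orP; left; apply/eqP; congr (_ * _).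
by apply: eq_bigr => j _; rewrite big_ord1 !mxE.
Qed.

(** Boundedness is what allows a member of the set to be compared with the supremum defining
    [spectral_norm]. *)
Lemma spectral_norm_has_ubound m n (M : 'M[R]_(m, n)) :
  has_ubound [set mxnormF (M *m x) | x in [set x : 'cV[R]_n | mxnormF x <= 1]].
Proof.
exists (mxnormF M) => _ [x /= x1 <-].
rewrite -ler_sqr ?nnegrE ?sqrtr_ge0 // !mxnormF_sqr.
apply: le_trans (mxdot_mulmx_le _ _) _.
apply: ler_piMr; first exact: mxdot_ge0.
by rewrite -mxnormF_sqr expr_le1 // sqrtr_ge0.
Qed.

Lemma spectral_norm_ge0 m n (M : 'M[R]_(m, n)) : 0 <= spectral_norm M.
Proof.
apply: ub_le_sup; first exact: spectral_norm_has_ubound.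
exists 0 => /=; first by rewrite mxnormF0 ler01.
by rewrite mulmx0 mxnormF0.
Qed.

Lemma mxnormFZ m n a (M : 'M[R]_(m, n)) : mxnormF (a *: M) = `|a| * mxnormF M.
Proof.
rewrite /mxnormF mxdotZr mxdotC mxdotZr mulrA -expr2.
by rewrite sqrtrM ?sqr_ge0 // sqrtr_sqr.
Qed.

Lemma mxnormF_mulmx_le m n (M : 'M[R]_(m, n)) (x : 'cV[R]_n) :
  mxnormF (M *m x) <= spectral_norm M * mxnormF x.
Proof.
have := sqrtr_ge0 (mxdot x x); rewrite -/(mxnormF x) le_eqVlt.
case/orP => [/eqP x0|x_gt0].
  have -> : x = 0 by apply: mxdot_eq0; rewrite -mxnormF_sqr -x0 expr0n.
  by rewrite mulmx0 !mxnormF0 mulr0.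
rewrite -ler_pdivrMr // mulrC.
rewrite -[(mxnormF x)^-1]ger0_norm ?invr_ge0 ?sqrtr_ge0 // -mxnormFZ scalemxAr.
apply: ub_le_sup; first exact: spectral_norm_has_ubound.
exists ((mxnormF x)^-1 *: x) => //=.
by rewrite mxnormFZ ger0_norm ?invr_ge0 ?sqrtr_ge0 // mulVf ?gt_eqF.
Qed.

(** Squared Frobenius norms add up over columns, so the bound for vectors passes to the unfoldings
    of tensors with several columns. *)
Lemma mxdot_spectral_norm m n q (M : 'M[R]_(m, n)) (X : 'M[R]_(n, q)) :
  mxdot (M *m X) (M *m X) <= spectral_norm M ^+ 2 * mxdot X X.
Proof.
have mxdot_col k (Y : 'M[R]_(k, q)) :
    mxdot Y Y = \sum_j mxdot (col j Y) (col j Y).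
  rewrite /mxdot exchange_big; apply: eq_bigr => j _; apply: eq_bigr => i _.
  by rewrite big_ord1 !mxE.
rewrite !mxdot_col mulr_sumr; apply: ler_sum => j _.
have -> : col j (M *m X) = M *m col j X by rewrite !colE mulmxA.
rewrite -!mxnormF_sqr -exprMn ler_sqr ?nnegrE ?sqrtr_ge0 //.
  exact: mxnormF_mulmx_le.
by rewrite mulr_ge0 ?sqrtr_ge0 ?spectral_norm_ge0.
Qed.

(* [D := 1 - M^T M] is positive definite, hence invertible; expanding
   [(x - t y)^T D (x - t y) >= 0] at [y = D^-1 x] bounds [x^T D x] from below
   by a multiple of [|x|^2], which makes a compactness argument unnecessary. *)
Lemma spectral_norm_lt1 m n (M : 'M[R]_(m, n)) :
  (forall x : 'cV[R]_n, x != 0 -> mxdot (M *m x) (M *m x) < mxdot x x) ->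
  spectral_norm M < 1.
Proof.
move=> Mlt; set D : 'M[R]_n := 1%:M - M^T *m M.
have DE (x y : 'cV[R]_n) :
    mxdot x (D *m y) = mxdot x y - mxdot (M *m x) (M *m y).
  by rewrite mulmxBl mul1mx mxdotDr mxdotNr mxdot_mulmxl mulmxA.
have D_ge0 (x : 'cV[R]_n) : 0 <= mxdot x (D *m x).
  rewrite DE subr_ge0; have [->|/Mlt/ltW //] := eqVneq x 0.
  by rewrite mulmx0 !mxdot0r.
have DT : D^T = D by rewrite raddfB /= trmx1 trmx_mul trmxK.
have Du : D \in unitmx.
  rewrite -row_free_unit -kermx_eq0; apply/eqP/row_matrixP => i.
  rewrite row0; apply/eqP; apply: contraT => z0.
  set z := row i _ in z0; have zD : D *m z^T = 0.
    by apply: trmx_inj; rewrite trmx_mul trmxK DT -row_mul mulmx_ker row0 trmx0.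
  have /Mlt : z^T != 0 by rewrite -trmx0 (inj_eq trmx_inj).
  by rewrite -subr_gt0 -DE zD mxdot0r ltxx.
set c := mxdot (invmx D) (invmx D).
have c_ge0 : 0 <= c by exact: mxdot_ge0.
(* With this [t] one has t c = 1 - t. Since y^T x <= c |x|^2, the expansion yields x^T D x >= (2 t -
   t^2 c) |x|^2 = (t + t^2) |x|^2. *)
set t := (c + 1)^-1.
have c1_gt0 : 0 < c + 1 by lra.
have t_gt0 : 0 < t by rewrite invr_gt0.
have tc : t * c = 1 - t by rewrite /t; field; rewrite gt_eqF.
have Dx (x : 'cV[R]_n) : t * mxdot x x <= mxdot x (D *m x).
  set y := invmx D *m x.
  have Dy : D *m y = x by rewrite mulmxA mulmxV // mul1mx.
  have yy : mxdot y y <= c * mxdot x x by exact: mxdot_mulmx_le.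
  have := D_ge0 (x - t *: y).
  have yDx : mxdot y (D *m x) = mxdot x x by rewrite -{1}DT -mxdot_mulmxl Dy.
  have yx : mxdot y x <= c * mxdot x x.
    apply: le_trans yy; rewrite -[X in mxdot y X <= _]Dy DE lerBlDr lerDl.
    exact: mxdot_ge0.
  rewrite mulmxBr -scalemxAr Dy (mxdotC (x - _)) !(mxdotDr, mxdotNr, mxdotZr).
  rewrite (mxdotC (_ - _) x) (mxdotC (_ - _) y) !(mxdotDr, mxdotNr, mxdotZr).
  rewrite yDx => ge0.
  have : t * (t * mxdot y x) <= t * (t * (c * mxdot x x)).
    by rewrite !ler_pM2l.
  have -> : t * (t * (c * mxdot x x)) = t * (1 - t) * mxdot x x.
    by rewrite -tc; ring.
  have : 0 <= t * t * mxdot x x.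
    by rewrite mulr_ge0 ?mxdot_ge0 // mulr_ge0 // ltW.
  move: ge0; lra.
have t_le1 : t <= 1 by rewrite -[1]invr1 lef_pV2 ?posrE //; lra.
have le_sqrt : spectral_norm M <= Num.sqrt (1 - t).
  apply: ge_sup.
    exists (mxnormF (M *m (0 : 'cV[R]_n))), 0 => //=.
    by rewrite mxnormF0 ler01.
  move=> _ [x /= x1 <-]; rewrite ler_wsqrtr //.
  have xx1 : mxdot x x <= 1 by rewrite -mxnormF_sqr expr_le1 // sqrtr_ge0.
  have := Dx x; rewrite DE.
  have : (1 - t) * mxdot x x <= (1 - t) * 1.
    by rewrite ler_wpM2l // subr_ge0.
  lra.
apply: le_lt_trans le_sqrt _.
rewrite -[ltRHS]sqrtr1 ltr_sqrt ?ltr01 //; lra.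
Qed.

End Matrices.

(** * Algebra of the t-product and its inner product *)

Section Tensors.
Variables (R : realType) (n : nat).
Notation T m l := (tensor R m l n.+1).
Implicit Types m l p q : nat.

(** The t-product is the cyclic convolution of frontal slices; bilinearity and the unit laws are
    read off from this form. *)
Lemma tprodE m l p (A : T m l) (Y : T l p) k :
  (A *t Y) k = \sum_j A (k - j) *m Y j.
Proof.
rewrite ffunE /bcirc /unfold mxblockEv -submxcol_mul mxcolK.
by rewrite mul_mxrow_mxcol.
Qed.

Lemma unfold_tprod m l p (A : T m l) (Y : T l p) :
  unfold (A *t Y) = bcirc A *m unfold Y.
Proof. exact: unfoldK. Qed.

(** Together with the injectivity of [bcirc], this transfers matrix identities, the Penrose
    equations among them, to tensors. *)
Lemma bcirc_tprod m l p (A : T m l) (Y : T l p) :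
  bcirc (A *t Y) = bcirc A *m bcirc Y.
Proof.
rewrite /bcirc mul_mxblock; apply: eq_mxblock => i j; rewrite tprodE.
rewrite (reindex_inj (addIr (- j))) /=; apply: eq_bigr => k _.
by congr (A _ *m _); rewrite opprB addrA addrNK.
Qed.

Lemma tprodA m l p q (A : T m l) (Y : T l p) (Z : T p q) :
  A *t (Y *t Z) = A *t Y *t Z.
Proof.
by apply: (can_inj (@foldK _ _ _ _)); rewrite !unfold_tprod bcirc_tprod mulmxA.
Qed.

Lemma tprodDr m l p (A : T m l) (Y Z : T l p) : A *t (Y + Z) = A *t Y + A *t Z.
Proof.
apply/ffunP => k; rewrite !(tprodE, ffunE) -big_split.
by apply: eq_bigr => j _; rewrite ffunE mulmxDr.
Qed.

Lemma tprodDl m l p (A C : T m l) (Y : T l p) : (A + C) *t Y = A *t Y + C *t Y.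
Proof.
apply/ffunP => k; rewrite !(tprodE, ffunE) -big_split.
by apply: eq_bigr => j _; rewrite ffunE mulmxDl.
Qed.

Lemma tprodZr m l p a (A : T m l) (Y : T l p) : A *t (a *: Y) = a *: (A *t Y).
Proof.
apply/ffunP => k; rewrite !(tprodE, ffunE) scaler_sumr.
by apply: eq_bigr => j _; rewrite ffunE scalemxAr.
Qed.

Lemma tprodNr m l p (A : T m l) (Y : T l p) : A *t (- Y) = - (A *t Y).
Proof. by rewrite -scaleN1r tprodZr scaleN1r. Qed.

Lemma tprodNl m l p (A : T m l) (Y : T l p) : (- A) *t Y = - (A *t Y).
Proof.
apply/ffunP => k; rewrite !(tprodE, ffunE) -sumrN.
by apply: eq_bigr => j _; rewrite ffunE mulNmx.
Qed.

Lemma tprodBr m l p (A : T m l) (Y Z : T l p) : A *t (Y - Z) = A *t Y - A *t Z.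
Proof. by rewrite tprodDr tprodNr. Qed.

Lemma tprodBl m l p (A C : T m l) (Y : T l p) : (A - C) *t Y = A *t Y - C *t Y.
Proof. by rewrite tprodDl tprodNl. Qed.

Lemma tprod0r m l p (A : T m l) : A *t (0 : T l p) = 0.
Proof. by rewrite -(subrr 0) tprodBr subrr. Qed.

Lemma tprod_sumr m l p I (r : seq I) (P : pred I) (A : T m l)
    (F : I -> T l p) :
  A *t (\sum_(i <- r | P i) F i) = \sum_(i <- r | P i) A *t F i.
Proof. by apply: big_morph; [exact: tprodDr|exact: tprod0r]. Qed.

Lemma tid1l m l (Y : T m l) : tid R n m *t Y = Y.
Proof.
apply/ffunP => k; rewrite tprodE (bigD1 k) //= ffunE subrr eqxx mul1mx.
rewrite big1 ?addr0 // => j jk.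
by rewrite ffunE subr_eq0 eq_sym (negPf jk) mul0mx.
Qed.

Lemma tid1r m l (A : T m l) : A *t tid R n l = A.
Proof.
apply/ffunP => k; rewrite tprodE (bigD1 0) //= ffunE eqxx subr0 mulmx1.
by rewrite big1 ?addr0 // => j j0; rewrite ffunE (negPf j0) mulmx0.
Qed.

Lemma ttrM m l p (A : T m l) (Y : T l p) : ttr (A *t Y) = ttr Y *t ttr A.
Proof.
apply: (can_inj (@bcircK _ _ _ _)).
by rewrite !(ttrE, bcirc_tprod) trmx_mul.
Qed.

Section Pseudoinverse.
Variables (m l : nat) (A : T m l).

Lemma tprod_pinv : A *t tpinv A *t A = A.
Proof.
apply: (can_inj (@bcircK _ _ _ _)); rewrite !bcirc_tprod tpinvE.
by have [] := pinvP (bcirc A).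
Qed.

Lemma tpinv_prod : tpinv A *t A *t tpinv A = tpinv A.
Proof.
apply: (can_inj (@bcircK _ _ _ _)); rewrite !bcirc_tprod tpinvE.
by have [] := pinvP (bcirc A).
Qed.

Lemma ttr_pinvM : ttr (tpinv A *t A) = tpinv A *t A.
Proof.
apply: (can_inj (@bcircK _ _ _ _)); rewrite ttrE !bcirc_tprod tpinvE.
by have [] := pinvP (bcirc A).
Qed.

(** This is the transpose of A A^+ A = A, as A^+ A is symmetric: the projection A^+ A fixes the
    range of A^T. *)
Lemma tpinvM_ttr : tpinv A *t A *t ttr A = ttr A.
Proof. by rewrite -ttr_pinvM -ttrM tprodA tprod_pinv. Qed.

End Pseudoinverse.

Section InnerProduct.
Variables (m l : nat).
Implicit Types X Y Z : T m l.

Lemma tdotE X Y : tdot X Y = mxdot (unfold X) (unfold Y).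
Proof.
rewrite mxdot_trM /unfold tr_mxcol mul_mxrow_mxcol raddf_sum.
by apply: eq_bigr => k _; rewrite mxdot_trM.
Qed.

(** [mxvec] only re-indexes the entries, so [vec] is an isometry. *)
Lemma tdot_vec X Y : (vec X)^T *m vec Y = (tdot X Y)%:M.
Proof.
rewrite /vec tr_mxcol mul_mxrow_mxcol raddf_sum; apply: eq_bigr => k _.
apply/matrixP => i j; rewrite !ord1 trmxK [RHS]mxE mulr1n mxE /mxdot.
rewrite exchange_big pair_bigA /=.
rewrite (reindex _ (curry_mxvec_bij l m)); apply: eq_bigr => -[a b] _ /=.
by rewrite [(_^T) _ _]mxE !mxvecE !mxE.
Qed.

Lemma vecD X Y : vec (X + Y) = vec X + vec Y.
Proof.
rewrite /vec -mxcolD; apply: eq_mxcol => k.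
by rewrite ffunE !raddfD.
Qed.

Lemma vecZ a X : vec (a *: X) = a *: vec X.
Proof.
rewrite -mul_mx_scalar /vec mxcol_mul; apply: eq_mxcol => k.
by rewrite ffunE mul_mx_scalar !linearZ.
Qed.

Lemma tdotC X Y : tdot X Y = tdot Y X.
Proof. by rewrite !tdotE mxdotC. Qed.

Lemma tdotDr X Y Z : tdot X (Y + Z) = tdot X Y + tdot X Z.
Proof.
by rewrite -big_split; apply: eq_bigr => k _; rewrite ffunE mxdotDr.
Qed.

Lemma tdotZr a X Y : tdot X (a *: Y) = a * tdot X Y.
Proof.
by rewrite mulr_sumr; apply: eq_bigr => k _; rewrite ffunE mxdotZr.
Qed.

Lemma tdotNr X Y : tdot X (- Y) = - tdot X Y.
Proof. by rewrite -scaleN1r tdotZr mulN1r. Qed.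

Lemma tdot0r X : tdot X 0 = 0.
Proof. by rewrite -(scale0r X) tdotZr mul0r. Qed.

Lemma tdotBr X Y Z : tdot X (Y - Z) = tdot X Y - tdot X Z.
Proof. by rewrite tdotDr tdotNr. Qed.

Lemma tdotBl X Y Z : tdot (X - Y) Z = tdot X Z - tdot Y Z.
Proof. by rewrite !(tdotC _ Z) tdotBr. Qed.

Lemma tdot_ge0 X : 0 <= tdot X X.
Proof. by rewrite tdotE mxdot_ge0. Qed.

Lemma tdot_eq0 X : tdot X X = 0 -> X = 0.
Proof.
rewrite tdotE => /mxdot_eq0 X0; rewrite -[X]foldK X0.
by apply/ffunP => k; rewrite !ffunE submxcol0.
Qed.

Lemma tnorm_sqr X : tnorm X ^+ 2 = tdot X X.
Proof. by rewrite sqr_sqrtr ?tdot_ge0. Qed.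

Lemma tdot_sqrD X Y : tdot (X + Y) (X + Y) = tdot X X + 2 * tdot X Y + tdot Y Y.
Proof. rewrite !tdotDr !(tdotC (X + Y)) !tdotDr (tdotC Y X); ring. Qed.

End InnerProduct.

Lemma tdot_tprodl m l p (A : T m l) (X : T l p) (Y : T m p) :
  tdot (A *t X) Y = tdot X (ttr A *t Y).
Proof. by rewrite !tdotE !unfold_tprod mxdot_mulmxl ttrE. Qed.

Lemma hslice_tprod m l p (A : T m l) (Y : T l p) i :
  hslice (A *t Y) i = hslice A i *t Y.
Proof.
apply/ffunP => k; rewrite ffunE !tprodE raddf_sum.
by apply: eq_bigr => j _ /=; rewrite ffunE row_mul.
Qed.

Lemma hslice_inj m l (A C : T m l) :
  (forall i, hslice A i = hslice C i) -> A = C.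
Proof.
move=> AC; apply/ffunP => k; apply/row_matrixP => i.
by have /ffunP/(_ k) := AC i; rewrite !ffunE.
Qed.

End Tensors.

(** * Row projections and the identities of one sweep *)

Section Projections.
Variables (R : realType) (m l p n : nat).
Variables (A : tensor R m l n.+1) (B : tensor R m p n.+1).
Implicit Types X Y E : tensor R l p n.+1.

Section Solution.
Variable Y : tensor R l p n.+1.
Hypothesis solY : solution A B Y.

Lemma residualE j X :
  residual A B j X = tpinv (hslice A j) *t hslice A j *t (X - Y).
Proof. by rewrite /residual -solY hslice_tprod -tprodBr tprodA. Qed.

Lemma proj_subE j X :
  Defs.proj A B j X - Y
  = (tid R n l - tpinv (hslice A j) *t hslice A j) *t (X - Y).
Proof. by rewrite tprodBl tid1l -residualE /Defs.proj addrAC. Qed.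

(** A_j^+ A_j is symmetric and idempotent, so it splits the old error into two orthogonal parts: the
    residual and the new error. *)
Lemma proj_pythagoras j X :
  tdot (residual A B j X) (residual A B j X)
  = tdot (X - Y) (X - Y) - tdot (Defs.proj A B j X - Y) (Defs.proj A B j X - Y).
Proof.
rewrite /Defs.proj addrAC !residualE; set C := hslice A j; set E := X - Y.
have QE : tdot (tpinv C *t C *t E) (tpinv C *t C *t E)
        = tdot E (tpinv C *t C *t E).
  by rewrite tdot_tprodl ttr_pinvM tprodA (tprodA _ (tpinv C)) tpinv_prod.
rewrite (tdot_sqrD E) !tdotNr (tdotC (- _)) tdotNr QE; ring.
Qed.

Lemma residual0_row j X :
  residual A B j X = 0 -> hslice A j *t X = hslice B j.
Proof.
rewrite residualE => Q0; apply/eqP; rewrite -subr_eq0 -solY hslice_tprod.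
rewrite -tprodBr -(tprod_pinv (hslice A j)) -!tprodA.
by rewrite (tprodA (tpinv _)) Q0 tprod0r.
Qed.

End Solution.

Lemma proj_prefixS pi (i : 'I_m) X :
  proj_prefix A B pi i.+1 X = Defs.proj A B (pi i) (proj_prefix A B pi i X).
Proof.
rewrite /proj_prefix (take_nth i) ?size_enum_ord // nth_ord_enum.
by rewrite map_rcons foldl_rcons.
Qed.

Lemma proj_prefix0 pi X : proj_prefix A B pi 0 X = X.
Proof. by rewrite /proj_prefix take0. Qed.

Lemma residual_perm_sqr pi X :
  mxnormF (residual_perm A B pi X) ^+ 2
  = \sum_(i < m) tdot (residual A B (pi i) (proj_prefix A B pi i X))
                      (residual A B (pi i) (proj_prefix A B pi i X)).
Proof.
rewrite mxnormF_sqr mxdot_trM /residual_perm tr_mxcol mul_mxrow_mxcol raddf_sum.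
by apply: eq_bigr => i _; rewrite tdotE mxdot_trM.
Qed.

(** The Pythagorean identities of the single projections telescope along the sweep. *)
Lemma residual_perm_pythagoras pi X Y : solution A B Y ->
  mxnormF (residual_perm A B pi X) ^+ 2
  = tdot (X - Y) (X - Y)
    - tdot (proj_perm A B pi X - Y) (proj_perm A B pi X - Y).
Proof.
move=> solY; rewrite residual_perm_sqr.
pose f i := - tdot (proj_prefix A B pi i X - Y) (proj_prefix A B pi i X - Y).
rewrite (eq_bigr (fun i : 'I_m => f i.+1 - f i)) => [|i _].
  rewrite -(big_mkord xpredT (fun i => f i.+1 - f i)) telescope_sumr // /f.
  by rewrite proj_prefix0 opprK addrC.
by rewrite (proj_pythagoras solY) /f opprK -proj_prefixS addrC.
Qed.

(** If all residuals vanish, no projection moves [X], so every row equation is tested at [X]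
    itself. *)
Lemma residual_perm0 pi X Y : solution A B Y ->
  mxnormF (residual_perm A B pi X) ^+ 2 = 0 -> solution A B X.
Proof.
move=> solY; rewrite residual_perm_sqr => /psumr_eq0P res0.
have {}res0 (i : 'I_m) : residual A B (pi i) (proj_prefix A B pi i X) = 0.
  by apply/tdot_eq0/res0 => // j _; exact: tdot_ge0.
have prefixX i : (i <= m)%N -> proj_prefix A B pi i X = X.
  elim: i => [|i IHi im]; first by rewrite proj_prefix0.
  by rewrite (proj_prefixS _ (Ordinal im)) /Defs.proj res0 subr0 IHi // ltnW.
apply: hslice_inj => j; rewrite hslice_tprod; apply: (residual0_row solY).
(* The sweep treats row [j] at position pi^-1(j). *)
by have := res0 ((pi^-1)%g j); rewrite permKV prefixX // ltnW.
Qed.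

(** With d the sweep displacement and e = Y - X, telescoping gives |r|^2 = |e|^2 - |d - e|^2 = 2 <d,
    e> - |d|^2. Thus <d, e> is computable without knowing [Y]. *)
Lemma gamma_dot pi X Y : solution A B Y ->
  2^-1 * (mxnormF (residual_perm A B pi X) ^+ 2
          + tnorm (proj_perm A B pi X - X) ^+ 2)
  = tdot (proj_perm A B pi X - X) (Y - X).
Proof.
move=> solY; rewrite (residual_perm_pythagoras pi X solY) tnorm_sqr.
set d := _ - X; have -> : proj_perm A B pi X - Y = d - (Y - X).
  by rewrite /d opprB addrA subrK.
rewrite -(opprB Y X) (tdot_sqrD d) !tdotNr !(tdotC (- _)) !tdotNr; lra.
Qed.

(** A_j^+ = A_j^T (A_j^+)^T A_j^+ has its range inside that of A_j^T, hence inside that of A^T,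
    which A^+ A fixes. *)
Lemma tpinv_prod_fix j :
  tpinv A *t A *t tpinv (hslice A j) = tpinv (hslice A j).
Proof.
have AjQ : hslice A j *t (tpinv A *t A) = hslice A j.
  by rewrite -hslice_tprod tprodA tprod_pinv.
have QAj : tpinv A *t A *t ttr (hslice A j) = ttr (hslice A j).
  by rewrite -ttr_pinvM -ttrM AjQ.
rewrite -{1}(tpinv_prod (hslice A j)) -(ttr_pinvM (hslice A j)) ttrM.
by rewrite !tprodA QAj -ttrM ttr_pinvM tpinv_prod.
Qed.

Lemma residual_range j X :
  tpinv A *t A *t residual A B j X = residual A B j X.
Proof. by rewrite /residual tprodA tpinv_prod_fix. Qed.

Lemma proj_perm_range pi X :
  tpinv A *t A *t (proj_perm A B pi X - X) = proj_perm A B pi X - X.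
Proof.
suff prefix i : (i <= m)%N -> tpinv A *t A *t (proj_prefix A B pi i X - X)
    = proj_prefix A B pi i X - X by exact: prefix.
elim: i => [|i IHi] im.
  by rewrite proj_prefix0 subrr tprod0r.
rewrite (proj_prefixS _ (Ordinal im)) /Defs.proj addrAC tprodBr residual_range.
by rewrite IHi // ltnW.
Qed.

End Projections.

(** * Strict contraction of a sweep on the range of A^+ A *)

Section Contraction.
Variables (R : realType) (m l n : nat) (A : tensor R m l n.+1).

Lemma proj_perm_subE p (B : tensor R m p n.+1) pi X Y : solution A B Y ->
  proj_perm A B pi X - Y = T_perm A pi *t (X - Y).
Proof.
move=> solY; rewrite /proj_perm /proj_prefix /T_perm.
rewrite take_oversize ?size_enum_ord //.
elim/last_ind: [seq _ | _ <- _] => [|s j IHs]; first by rewrite tid1l.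
by rewrite !foldl_rcons (proj_subE solY) IHs tprodA.
Qed.

(** With G = A^+ A E, orthogonality and telescoping give |F|^2 = |E|^2 - |E - G|^2 - |r|^2. Equality
    forces E = G and r = 0, hence A E = 0 and E = A^+ A E = 0. One column is enough, since the
    spectral norm is a supremum over vectors. *)
Lemma T_perm_contract pi (E : tensor R l 1 n.+1) : E != 0 ->
  tdot (T_perm A pi *t tpinv A *t A *t E) (T_perm A pi *t tpinv A *t A *t E)
  < tdot E E.
Proof.
move=> E0; set F := _ *t E; set Q := tpinv A *t A; set G := Q *t E.
(* For the zero right-hand side, 0 is a solution and the sweep itself is multiplication by
   [T_perm A pi]. *)
have sol0 : solution A (0 : tensor R m 1 n.+1) 0 by rewrite /solution tprod0r.
have FE : F = proj_perm A 0 pi G - 0.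
  by rewrite (proj_perm_subE _ _ sol0) subr0 /F /G /Q -!tprodA.
have := residual_perm_pythagoras pi G sol0; rewrite -FE subr0 => resE.
have QE : tdot G G = tdot E G.
  by rewrite tdot_tprodl ttr_pinvM /G tprodA /Q (tprodA _ (tpinv A)) tpinv_prod.
have EG : tdot E E = tdot G G + tdot (E - G) (E - G).
  rewrite (tdot_sqrD E) !tdotNr (tdotC (- _)) tdotNr QE; ring.
rewrite lt_neqAle; apply/andP; split; last first.
  rewrite EG -lerBlDl -[leLHS]opprK -opprB; have := tdot_ge0 (E - G).
  have := sqr_ge0 (mxnormF (residual_perm A 0 pi G)); rewrite resE; lra.
apply: contra E0 => /eqP FE_eq; move: resE; rewrite FE_eq EG => resE.
have EG_ge0 := tdot_ge0 (E - G).
have res_ge0 := sqr_ge0 (mxnormF (residual_perm A 0 pi G)).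
have res0 : mxnormF (residual_perm A 0 pi G) ^+ 2 = 0 by lra.
have EG0 : E - G = 0 by apply: tdot_eq0; lra.
have := residual_perm0 sol0 res0; rewrite /solution /G tprodA /Q tprodA.
rewrite tprod_pinv => AE0.
by rewrite -[E](subrK G) EG0 add0r /G /Q -tprodA AE0 tprod0r.
Qed.

Lemma rho_perm_lt1 pi : rho_perm A pi < 1.
Proof.
rewrite /rho_perm expr_lt1 ?spectral_norm_ge0 //.
apply: spectral_norm_lt1 => x x0.
rewrite -[x]unfoldK -unfold_tprod -!tdotE; apply: T_perm_contract.
apply: contra x0 => /eqP fx0; rewrite -[x]unfoldK fx0.
by apply/eqP/matrixP => i j; rewrite !mxE ffunE mxE.
Qed.

Lemma rho_max_lt1 : rho_max A < 1.
Proof. by apply: bigmax_lt => [|pi _]; [exact: ltr01|exact: rho_perm_lt1]. Qed.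

Lemma rho_perm_le_max pi : rho_perm A pi <= rho_max A.
Proof. exact: le_bigmax. Qed.

Lemma rho_max_ge0 : 0 <= rho_max A.
Proof. exact: bigmax_ge_id. Qed.

Lemma proj_perm_contract p (B : tensor R m p n.+1) pi X Y : solution A B Y ->
  tpinv A *t A *t (X - Y) = X - Y ->
  tdot (proj_perm A B pi X - Y) (proj_perm A B pi X - Y)
  <= rho_max A * tdot (X - Y) (X - Y).
Proof.
(* Inserting A^+ A before the error produces exactly the matrix whose norm defines [rho_perm]. *)
move=> solY XY; rewrite (proj_perm_subE _ _ solY) -{1 2}XY.
rewrite tprodA (tprodA _ (tpinv A)) !tdotE unfold_tprod; apply: le_trans (mxdot_spectral_norm _ _) _.
by apply: ler_wpM2r; [exact: mxdot_ge0|exact: rho_perm_le_max].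
Qed.

End Contraction.

(** * Linearity of the vectorization *)

Section Vectorization.
Variables (R : realType) (n m l : nat).
Implicit Types X Y : tensor R m l n.+1.

Lemma vecB X Y : vec (X - Y) = vec X - vec Y.
Proof. by rewrite vecD -(scaleN1r Y) vecZ scaleN1r. Qed.

Lemma vec_sum I (r : seq I) (P : pred I) (F : I -> tensor R m l n.+1) :
  vec (\sum_(i <- r | P i) F i) = \sum_(i <- r | P i) vec (F i).
Proof.
apply: (big_morph _ (@vecD R n m l)).
by rewrite -(scale0r (0 : tensor R m l n.+1)) vecZ scale0r.
Qed.

End Vectorization.

(** * The linear system of one step of the algorithm *)

Section Algorithm.
Variables (R : realType) (m l p n : nat).
Variables (A : tensor R m l n.+1) (B : tensor R m p n.+1).
Variables (tau : nat) (pi : nat -> 'S_m).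
Implicit Types (X : nat -> tensor R l p n.+1) (Y Z : tensor R l p n.+1).

Lemma tkgk_j_monotone k : (tkgk_j tau k <= tkgk_j tau k.+1)%N.
Proof. by rewrite /tkgk_j leq_sub2r. Qed.

Lemma tkgk_j_lt k (i : 'I_(k - tkgk_j tau k)) : (tkgk_j tau k + i < k)%N.
Proof. by rewrite -ltn_subRL. Qed.

Lemma tkgk_stoppedS X k : tkgk_stopped A B pi X k -> tkgk_stopped A B pi X k.+1.
Proof. by case=> i ik; exists i => //; exact: leqW. Qed.

Lemma tkgk_M_history X k Z i :
  ((tkgk_M A B tau pi X k)^T *m vec Z) (lshift 1 i) 0
  = tdot (X (tkgk_j tau k + i)%N - X k) Z.
Proof.
rewrite /tkgk_M tr_row_mx mul_col_mx col_mxEu.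
transitivity (((vec (X (tkgk_j tau k + i)%N - X k))^T *m vec Z) 0 0).
  by rewrite !mxE; apply: eq_bigr => a _; rewrite vecB !mxE.
by rewrite tdot_vec mxE mulr1n.
Qed.

Lemma tkgk_M_dir X k Z :
  ((tkgk_M A B tau pi X k)^T *m vec Z) (rshift (k - tkgk_j tau k) 0) 0
  = tdot (tkgk_dir A B pi X k) Z.
Proof.
by rewrite /tkgk_M tr_row_mx mul_col_mx col_mxEd tdot_vec mxE mulr1n.
Qed.

Lemma vec_tkgk_update X k s :
  vec (tkgk_update A B pi X s) = vec (X k) + tkgk_M A B tau pi X k *m s.
Proof.
rewrite /tkgk_update !vecD vecZ -addrA; congr (_ + _).
rewrite -[s in RHS]vsubmxK /tkgk_M mul_row_col; congr (_ + _).
  rewrite vec_sum; apply/matrixP => a b; rewrite summxE mxE.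
  apply: eq_bigr => i _.
  by rewrite vecZ vecB !mxE !ord1 mulrC.
by apply/matrixP => a b; rewrite !mxE big_ord1 !mxE !ord1 mulrC.
Qed.

(** * Orthogonality of the error to the stored differences *)

Section Orthogonality.
Variables (X : nat -> tensor R l p n.+1) (Y : tensor R l p n.+1).
Hypothesis solY : solution A B Y.

(** The invariant of the iteration, over the iterates in memory at step [k]. It annihilates all
    entries of M_k^T vec(Y - X^k) but the last. *)
Definition tkgk_orth k := forall i, (tkgk_j tau k <= i < k)%N ->
  tdot (X i - X k) (Y - X k) = 0.

(** The history entries vanish by the invariant and the last one is gamma_k by [gamma_dot]; so the
    system for s^k consists of normal equations. *)
Lemma tkgk_normal_rhs k : tkgk_orth k ->
  (tkgk_M A B tau pi X k)^T *m vec (Y - X k)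
  = tkgk_gamma A B pi X k *: delta_mx (rshift (k - tkgk_j tau k) 0) 0.
Proof.
move=> orth; apply/colP => i; rewrite [RHS]mxE [X in _ * X]mxE andbT.
rewrite -[i]splitK; case: (fintype.split i) => j /=.
  rewrite tkgk_M_history orth ?leq_addr ?tkgk_j_lt //.
  by rewrite eq_lrshift mulr0.
rewrite ord1 tkgk_M_dir eqxx mulr1 /tkgk_gamma /tkgk_delta /tkgk_dir.
by rewrite (gamma_dot (pi k) (X k) solY).
Qed.

(** The new error is a least-squares residual, orthogonal to the columns of M_k; the step X^(k+1) -
    X^k = M_k s lies in their span. *)
Lemma tkgk_step_ortho k : tkgk_step A B tau pi X k ->
  ~ tkgk_stopped A B pi X k -> tkgk_orth k ->
  (tkgk_M A B tau pi X k)^T *m vec (Y - X k.+1) = 0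
  /\ tdot (X k.+1 - X k) (Y - X k.+1) = 0.
Proof.
move=> [_ /[apply] [[s sE XS]]] /tkgk_normal_rhs rhs.
have vXS : vec (X k.+1 - X k) = tkgk_M A B tau pi X k *m s.
  by rewrite vecB XS vec_tkgk_update addrC addKr.
have M0 : (tkgk_M A B tau pi X k)^T *m vec (Y - X k.+1) = 0.
  have -> : Y - X k.+1 = (Y - X k) - (X k.+1 - X k).
    by rewrite opprB addrA subrK.
  rewrite vecB vXS mulmxBr rhs mulmxA sE.
  exact: subrr.
split=> //; have := tdot_vec (X k.+1 - X k) (Y - X k.+1).
rewrite vXS trmx_mul -mulmxA M0 mulmx0 => /matrixP/(_ 0 0).
by rewrite !mxE mulr1n.
Qed.

(** The window only moves forward, so a retained X^i - X^(k+1) is a column of M_k minus the last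
    step, both orthogonal to the new error. Assuming only the steps before [k] lets the lemma serve
    while a sequence is being constructed. *)
Lemma tkgk_orthP k : (forall i, (i < k)%N -> tkgk_step A B tau pi X i) ->
  ~ tkgk_stopped A B pi X k -> tkgk_orth k.
Proof.
elim: k => [_ _ i|k IHk step nstop i]; first by rewrite ltn0 andbF.
have nstopk : ~ tkgk_stopped A B pi X k by move=> /tkgk_stoppedS.
have orthk : tkgk_orth k by apply: IHk nstopk => j jk; apply: step; exact: leqW.
have [M0 XS0] := tkgk_step_ortho (step k (leqnn _)) nstopk orthk.
rewrite ltnS [(i <= k)%N]leq_eqVlt => /andP[ji /predU1P[->|ik]].
  by rewrite -(opprB (X k.+1)) tdotC tdotNr tdotC XS0 oppr0.
have jik := leq_trans (tkgk_j_monotone k) ji.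
(* X^i - X^k is column i - j_k of M_k, because j_k <= j_(k+1) <= i. *)
have i_lt : (i - tkgk_j tau k < k - tkgk_j tau k)%N.
  by rewrite ltn_sub2r // (leq_ltn_trans jik).
have := tkgk_M_history X (Y - X k.+1) (Ordinal i_lt).
rewrite M0 mxE /= subnKC // => /esym Xi0.
have -> : X i - X k.+1 = (X i - X k) - (X k.+1 - X k).
  by rewrite opprB addrA subrK.
by rewrite tdotBl Xi0 XS0 subrr.
Qed.

End Orthogonality.

(** * Linear convergence *)

Section Convergence.
Variables (X : nat -> tensor R l p n.+1) (Y : tensor R l p n.+1).
Hypothesis solY : solution A B Y.
Hypothesis stepX : forall k, tkgk_step A B tau pi X k.
Hypothesis rangeX0 : tpinv A *t A *t (X 0%N - Y) = X 0%N - Y.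

(** Strong induction, since an update combines several earlier iterates; differences of iterates are
    differences of errors. *)
Lemma tkgk_range k : tpinv A *t A *t (X k - Y) = X k - Y.
Proof.
elim/ltn_ind: k => -[//|k] IHk; have [stop nstop] := stepX k.
have [/stop ->|/nstop[s _ ->]] := pselect (tkgk_stopped A B pi X k).
  exact: IHk.
rewrite /tkgk_update addrAC (addrAC (X k)) tprodDr tprodDr IHk // tprodZr.
rewrite proj_perm_range tprod_sumr; congr (_ + _ + _).
apply: eq_bigr => i _; rewrite tprodZr; congr (_ *: _).
have -> Z : Z - X k = (Z - Y) - (X k - Y) by rewrite opprB addrA subrK.
by rewrite tprodBr !IHk // ltnS ltnW // tkgk_j_lt.
Qed.

(** A zero displacement means that the sweep fixes X^i; as it contracts the error by a factor below
    1, the error is 0. *)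
Lemma tkgk_stopped_solution k : tkgk_stopped A B pi X k -> X k = Y.
Proof.
case=> i ik delta0; have di : proj_perm A B (pi i) (X i) = X i.
  apply/eqP; rewrite -subr_eq0; apply/eqP/tdot_eq0.
  by rewrite -tnorm_sqr.
have XiY : X i = Y.
  apply/eqP; rewrite -subr_eq0; apply/eqP/tdot_eq0/le_anti.
  rewrite tdot_ge0 andbT.
  have := proj_perm_contract (pi i) solY (tkgk_range i).
  rewrite di -subr_le0 -{1}[tdot _ _]mul1r -mulrBl pmulr_rle0 //.
  by rewrite subr_gt0 rho_max_lt1.
elim: k ik => [|k IHk]; rewrite leq_eqVlt => /predU1P[<- //|] // ik.
by have [stop _] := stepX k; rewrite stop; [exact: IHk|exists i].
Qed.

Lemma tkgk_descent k :
  tdot (X k.+1 - Y) (X k.+1 - Y) <= rho_max A * tdot (X k - Y) (X k - Y).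
Proof.
have [stopk|nstopk] := pselect (tkgk_stopped A B pi X k).
  have := tkgk_stopped_solution stopk.
  have := tkgk_stopped_solution (tkgk_stoppedS stopk) => -> ->.
  by rewrite subrr tdot0r mulr0.
have orthk : tkgk_orth X Y k by apply: tkgk_orthP.
have [M0 XS0] := tkgk_step_ortho solY (stepX k) nstopk orthk.
have := tkgk_M_dir X k (Y - X k.+1); rewrite M0 mxE => /esym d0.
apply: le_trans _ (proj_perm_contract (pi k) solY (tkgk_range k)).
(* The second summand is a combination of columns of M_k, hence orthogonal to the first; Pythagoras
   then compares X^(k+1) with the plain sweep. *)
have -> : proj_perm A B (pi k) (X k) - Y
    = (X k.+1 - Y) + (tkgk_dir A B pi X k - (X k.+1 - X k)).
  rewrite /tkgk_dir (opprB (X k.+1)) (addrA (_ - X k)) subrK.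
  by rewrite [RHS]addrC addrA subrK.
have cross : tdot (X k.+1 - Y) (tkgk_dir A B pi X k - (X k.+1 - X k)) = 0.
  by rewrite tdotC tdotBl -(opprB Y) !tdotNr d0 XS0 subrr.
rewrite [leRHS]tdot_sqrD cross mulr0 addr0.
by rewrite lerDl tdot_ge0.
Qed.

Lemma tkgk_rate k :
  tdot (X k - Y) (X k - Y) <= rho_max A ^+ k * tdot (X 0%N - Y) (X 0%N - Y).
Proof.
elim: k => [|k IHk]; first by rewrite expr0 mul1r.
apply: le_trans (tkgk_descent k) _.
by rewrite exprS -mulrA ler_wpM2l // rho_max_ge0.
Qed.

Lemma tkgk_cvg : tnorm (X k - Y) @[k --> \oo] --> 0.
Proof.
rewrite -(sqrtr0 R); apply: continuous_cvg; first exact: sqrt_continuous.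
apply: (squeeze_cvgr (f := fun=> 0)
  (h := geometric (tdot (X 0%N - Y) (X 0%N - Y)) (rho_max A))).
- by near=> k; rewrite tdot_ge0 /= mulrC tkgk_rate.
- exact: cvg_cst.
- by apply: cvg_geometric; rewrite ger0_norm ?rho_max_ge0 // rho_max_lt1.
Unshelve. all: end_near. Qed.

End Convergence.

(** * Existence of a run *)

Section Existence.
Variables (Y X0 : tensor R l p n.+1).
Hypothesis solY : solution A B Y.

(** The pseudoinverse selects a least-squares solution, which solves the normal equations whatever
    the rank of M_k. *)
Definition tkgk_next X k : tensor R l p n.+1 :=
  if `[< tkgk_stopped A B pi X k >] then X k
  else tkgk_update A B pi X
         (Defs.pinv (tkgk_M A B tau pi X k) *m vec (Y - X k)).

Lemma tkgk_next_ext X X' k : (forall i, (i <= k)%N -> X i = X' i) ->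
  tkgk_next X k = tkgk_next X' k.
Proof.
move=> XX'.
have dirE : tkgk_dir A B pi X k = tkgk_dir A B pi X' k.
  by rewrite /tkgk_dir XX'.
have ME : tkgk_M A B tau pi X k = tkgk_M A B tau pi X' k.
  rewrite /tkgk_M dirE; congr row_mx; apply/matrixP => a i.
  by rewrite !mxE !XX' // ltnW // tkgk_j_lt.
have stopE : tkgk_stopped A B pi X k = tkgk_stopped A B pi X' k.
  rewrite /tkgk_stopped; apply/propext; split=> -[i ik <-]; exists i => //;
  by rewrite /tkgk_delta /tkgk_dir XX'.
rewrite /tkgk_next stopE ME XX' // /tkgk_update dirE XX' //.
case: ifP => // _; congr (_ + _ + _).
by apply: eq_bigr => i _; rewrite XX' // ltnW // tkgk_j_lt.
Qed.

(** Course-of-values recursion: [tkgk_hist k] holds the iterates up to index [k] and repeats the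
    last one beyond it. *)
Fixpoint tkgk_hist k : nat -> tensor R l p n.+1 :=
  if k is k'.+1 then
    fun i => if (i <= k')%N then tkgk_hist k' i else tkgk_next (tkgk_hist k') k'
  else fun=> X0.

Lemma tkgk_hist_stable k i : (i <= k)%N -> tkgk_hist k i = tkgk_hist i i.
Proof.
elim: k => [|k IHk]; first by rewrite leqn0 => /eqP ->.
by rewrite leq_eqVlt => /predU1P[-> //|ik]; rewrite /= -ltnS ik IHk.
Qed.

Lemma tkgk_exists : exists X, tkgk A B tau pi X X0.
Proof.
pose X k := tkgk_hist k k.
have XS k : X k.+1 = tkgk_next X k.
  rewrite {1}/X /= ltnn; apply: tkgk_next_ext => i ik.
  exact: tkgk_hist_stable.
exists X; split=> //; elim/ltn_ind => k stepX.
split=> [stop|nstop]; first by rewrite XS /tkgk_next asboolT.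
set M := tkgk_M A B tau pi X k.
exists (Defs.pinv M *m vec (Y - X k)); last by rewrite XS /tkgk_next asboolF.
rewrite -(tkgk_normal_rhs solY (tkgk_orthP solY stepX nstop)) -/M.
(* M^T M M^+ = (M M^+ M)^T = M^T. *)
have [MNM _ MNT _] := pinvP M.
by rewrite -mulmxA (mulmxA M) mulmxA -MNT -trmx_mul MNM.
Qed.

End Existence.
End Algorithm.

(** * The limit point and the least-norm solution *)

Section LeastNorm.
Variables (R : realType) (m l p n : nat).
Variables (A : tensor R m l n.+1) (B : tensor R m p n.+1).
Hypothesis consistent : exists X, solution A B X.

Lemma solution_pinv : solution A B (tpinv A *t B).
Proof.
by case: consistent => X <-; rewrite /solution !tprodA tprod_pinv.
Qed.

Lemma solution_Xstar X0 : solution A B (Xstar A B X0).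
Proof.
rewrite /solution /Xstar tprodDr solution_pinv tprodA tprodBr tid1r.
by rewrite tprodA tprod_pinv tprodBl subrr addr0.
Qed.

(** The initial error equals A^+ (A X^0 - B). This starts the induction that keeps all errors in the
    range of A^+ A. *)
Lemma Xstar_range X0 :
  tpinv A *t A *t (X0 - Xstar A B X0) = X0 - Xstar A B X0.
Proof.
have -> : X0 - Xstar A B X0 = tpinv A *t (A *t X0 - B).
  rewrite /Xstar tprodBl tid1l tprodBr tprodA.
  by rewrite opprD opprB addrCA (addrC X0) subrK addrC.
by rewrite tprodA tpinv_prod.
Qed.

Lemma Xstar_rangeK X0 : rangeK (ttr A) X0 -> Xstar A B X0 = tpinv A *t B.
Proof.
case=> Z _ <-; rewrite /Xstar tprodBl tid1l tprodA tpinvM_ttr subrr.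
by rewrite addr0.
Qed.

(** A^+ B lies in the range of the orthogonal projection A^+ A, and any other solution differs from
    it by an element of the kernel; Pythagoras gives minimality and uniqueness. *)
Lemma least_norm_pinv : unique (least_norm_solution A B) (tpinv A *t B).
Proof.
have pythagoras X : solution A B X ->
    tdot X X = tdot (tpinv A *t B) (tpinv A *t B)
               + tdot (X - tpinv A *t B) (X - tpinv A *t B).
  move=> solX.
  have cross : tdot (tpinv A *t B) (X - tpinv A *t B) = 0.
    have QX : tpinv A *t A *t (X - tpinv A *t B) = 0.
      rewrite -solX tprodA tprodBr (tprodA _ (_ *t A)) tprodA.
      by rewrite tpinv_prod subrr.
    rewrite -{1}tpinv_prod -(tprodA (_ *t A)) tdot_tprodl ttr_pinvM QX.
    exact: tdot0r.
  have := tdot_sqrD (tpinv A *t B) (X - tpinv A *t B).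
  by rewrite cross mulr0 addr0 (addrC (tpinv A *t B)) subrK.
split=> [|X [solX Xmin]].
  split; first exact: solution_pinv.
  by move=> X /pythagoras XE; rewrite ler_wsqrtr // XE lerDl tdot_ge0.
apply/esym/eqP; rewrite -subr_eq0; apply/eqP/tdot_eq0/le_anti.
rewrite tdot_ge0 andbT.
have := Xmin _ solution_pinv.
rewrite -ler_sqr ?nnegrE ?sqrtr_ge0 // !tnorm_sqr (pythagoras _ solX).
by rewrite gerDl.
Qed.

End LeastNorm.

Theorem mainTheorem2 (R : realType) (m l p n : nat)
    (A : tensor R m l n.+1) (B : tensor R m p n.+1) (X0 : tensor R l p n.+1)
    (tau : nat) (st : strategy) (pi : nat -> 'S_m) :
  (exists X, solution A B X) ->
  (1 <= tau)%N ->
  drawn_by st pi ->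
  [/\ rho_max A < 1,
      exists X, tkgk A B tau pi X X0,
      forall X, tkgk A B tau pi X X0 -> forall k,
        tnorm (X k - Xstar A B X0) ^+ 2
          <= rho_max A ^+ k * tnorm (X0 - Xstar A B X0) ^+ 2
    & rangeK (ttr A) X0 ->
      [/\ Xstar A B X0 = tpinv A *t B,
          unique (least_norm_solution A B) (tpinv A *t B)
        & forall X, tkgk A B tau pi X X0 ->
          tnorm (X k - tpinv A *t B) @[k --> \oo] --> 0]].
Proof.
move=> consistent _ _; have solY := solution_Xstar consistent X0.
have rangeX := Xstar_range A B X0.
split; first exact: rho_max_lt1.
- exact: tkgk_exists solY.
- move=> X [X00 stepX] k; rewrite !tnorm_sqr.
  by have := tkgk_rate solY stepX; rewrite X00 => /(_ rangeX k).
- move=> X0range; have XE := Xstar_rangeK B X0range.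
  split=> //; first exact: least_norm_pinv.
  move=> X [X00 stepX]; rewrite -XE.
  by apply: tkgk_cvg solY stepX _; rewrite X00.
Qed.
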